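(* Let $\mathfrak S$ be a semigroup with unit $1$, let $\mathcal E$ and $\mathcal F$ be linear spaces, and let $\varphi\colon\mathfrak S\to\mathbf L(\mathcal F,\mathcal E)$ be a mapping. With $\mathcal D$, $\varPhi(\mathfrak u)$ $(\mathfrak u\in\mathfrak S)$, $T$ and $S$ defined from $\varphi$ as in the context, the following hold. (a) The mapping $\varPhi\colon\mathfrak S\ni\mathfrak u\mapsto\varPhi(\mathfrak u)\in\mathbf L(\mathcal D)$ is a unital semigroup homomorphism; in particular, if $\mathfrak S$ is commutative then so is the range $\{\varPhi(\mathfrak u):\mathfrak u\in\mathfrak S\}$ of $\varPhi$. (b) The dilation formula $\varphi(\mathfrak u)=S\varPhi(\mathfrak u)T$ holds for every $\mathfrak u\in\mathfrak S$. (c) The minimality condition $\mathcal D=\operatorname{lin}\{\varPhi(\mathfrak u)Tf:\ \mathfrak u\in\mathfrak S,\ f\in\mathcal F\}$ holds. (d) If, in addition, $\mathfrak S$ is an algebra (whose multiplication is the semigroup operation) and $\varphi$ is linear, then $\varPhi$ is an algebra homomorphism.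
   Context: All linear spaces are over a common scalar field ($\mathbb R$ or $\mathbb C$). $\mathbf L(\mathcal F,\mathcal E)$ is the space of all linear maps $\mathcal F\to\mathcal E$, $\mathbf L(\mathcal D)=\mathbf L(\mathcal D,\mathcal D)$, and $\operatorname{lin}$ denotes linear span. For $\mathfrak s\in\mathfrak S$ and $f\in\mathcal F$ let $\varphi_{\mathfrak s,f}\in\mathcal E^{\mathfrak S}$ be the function $\varphi_{\mathfrak s,f}(\mathfrak t)=\varphi(\mathfrak t\mathfrak s)f$, $\mathfrak t\in\mathfrak S$. Let $\mathcal D=\operatorname{lin}\{\varphi_{\mathfrak s,f}:\mathfrak s\in\mathfrak S,f\in\mathcal F\}\subset\mathcal E^{\mathfrak S}$. For $\mathfrak u\in\mathfrak S$, $\varPhi(\mathfrak u)\colon\mathcal D\to\mathcal D$ is the (well defined) linear operator determined by $\varPhi(\mathfrak u)\varphi_{\mathfrak s,f}=\varphi_{\mathfrak u\mathfrak s,f}$ for all $\mathfrak s\in\mathfrak S$, $f\in\mathcal F$. $T\colon\mathcal F\to\mathcal D$ is the linear operator $Tf=\varphi_{1,f}$, and $S\colon\mathcal D\to\mathcal E$ is the (well defined) linear operator determined by $S\varphi_{\mathfrak s,f}=\varphi(\mathfrak s)f$ for all $\mathfrak s\in\mathfrak S$, $f\in\mathcal F$. *)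

(* Defs.v *)
From HB Require Import structures.
From mathcomp Require Import all_boot all_order all_algebra.
From mathcomp Require Import boolp classical_sets functions reals complex.

Set Implicit Arguments.
Unset Strict Implicit.
Unset Printing Implicit Defensive.

Import GRing.Theory.

Local Open Scope classical_set_scope.
Local Open Scope ring_scope.

Variant scalar_kind := RealScalars | ComplexScalars.

Definition scalar_field (R : realType) (k : scalar_kind) : fieldType :=
  match k with
  | RealScalars => R
  | ComplexScalars => R[i]
  end.

(* The multiplication is the one of the monoid structure (in group_scope).
   Contrary to algType, the algebra may be zero: this is needed for L(D), since
   D = 0 is possible. *)
HB.mixin Record Monoid_isUnitalAlgebra (K : pzRingType) A
    of Monoid A & GRing.Lmodule K A := {
  mulg_linearl : forall y : A, linear (fun x : A => (x * y)%g);
  mulg_linearr : forall x : A, linear (fun y : A => (x * y)%g)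
}.

#[short(type="unitalAlgType")]
HB.structure Definition UnitalAlgebra (K : pzRingType) :=
  {A of Monoid A & GRing.Lmodule K A & Monoid_isUnitalAlgebra K A}.

Definition algebra_morphism (K : pzRingType) (A B : unitalAlgType K)
    (f : A -> B) : Prop :=
  linear f /\ monoid.monoid_morphism f.

Section LinearMaps.
Variables (K : comPzRingType) (U V : lmodType K).
Implicit Types (f g : {linear U -> V}) (a b : K).

HB.instance Definition _ := gen_eqMixin {linear U -> V}.
HB.instance Definition _ := gen_choiceMixin {linear U -> V}.

Lemma linear_ext f g : f =1 g -> f = g.
Proof.
case: f g => [f cf] [g cg] /= /funext fg; rewrite fg in cf *.
congr GRing.Linear.Pack; case: cf cg => [[cf1] [cf2]] [[cg1] [cg2]].
by congr GRing.Linear.Class; congr (_ _); exact: Prop_irrelevance.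
Qed.

Definition linear_zero : {linear U -> V} := \0.
Definition linear_add f g : {linear U -> V} := f \+ g.
Definition linear_opp f : {linear U -> V} := \- f.
Definition linear_scale a f : {linear U -> V} := a \*: f.

Fact linear_addA : associative linear_add.
Proof. by move=> f g h; apply: linear_ext => x /=; rewrite addrA. Qed.
Fact linear_addC : commutative linear_add.
Proof. by move=> f g; apply: linear_ext => x /=; rewrite addrC. Qed.
Fact linear_add0 : left_id linear_zero linear_add.
Proof. by move=> f; apply: linear_ext => x /=; rewrite add0r. Qed.
Fact linear_addN : left_inverse linear_zero linear_opp linear_add.
Proof. by move=> f; apply: linear_ext => x /=; rewrite addNr. Qed.

HB.instance Definition _ := GRing.isZmodule.Build {linear U -> V}
  linear_addA linear_addC linear_add0 linear_addN.

Fact linear_scaleA a b f :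
  linear_scale a (linear_scale b f) = linear_scale (a * b) f.
Proof. by apply: linear_ext => x /=; rewrite scalerA. Qed.
Fact linear_scale1 : left_id 1 linear_scale.
Proof. by move=> f; apply: linear_ext => x /=; rewrite scale1r. Qed.
Fact linear_scaleDr : right_distributive linear_scale +%R.
Proof. by move=> a f g; apply: linear_ext => x /=; rewrite scalerDr. Qed.
Fact linear_scaleDl f : {morph linear_scale^~ f : a b / a + b}.
Proof. by move=> a b; apply: linear_ext => x /=; rewrite scalerDl. Qed.

HB.instance Definition _ := GRing.Zmodule_isLmodule.Build K {linear U -> V}
  linear_scaleA linear_scale1 linear_scaleDr linear_scaleDl.

End LinearMaps.

Section LinearEndomorphisms.
Variables (K : comPzRingType) (V : lmodType K).
Implicit Types P Q : {linear V -> V}.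

Definition linear_comp P Q : {linear V -> V} := P \o Q.
Definition linear_id : {linear V -> V} := idfun.

Fact linear_compA : associative linear_comp.
Proof. by move=> P Q W; exact: linear_ext. Qed.
Fact linear_comp1l : left_id linear_id linear_comp.
Proof. by move=> P; exact: linear_ext. Qed.
Fact linear_comp1r : right_id linear_id linear_comp.
Proof. by move=> P; exact: linear_ext. Qed.

HB.instance Definition _ := isMonoid.Build {linear V -> V}
  linear_compA linear_comp1l linear_comp1r.

Fact linear_comp_linearl Q : linear (fun P => (P * Q)%g).
Proof. by move=> a P P'; exact: linear_ext. Qed.
Fact linear_comp_linearr P : linear (fun Q => (P * Q)%g).
Proof. by move=> a Q Q'; apply: linear_ext => x /=; rewrite linearP. Qed.

HB.instance Definition _ := Monoid_isUnitalAlgebra.Build K {linear V -> V}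
  linear_comp_linearl linear_comp_linearr.

End LinearEndomorphisms.

Section LinearSpan.
Variables (K : pzRingType) (V : lmodType K) (X : set V).

Definition lin : set V :=
  [set v | exists n (c : 'I_n -> K) (x : 'I_n -> V),
    (forall i, X (x i)) /\ v = \sum_(i < n) c i *: x i].

Definition lin_pred : {pred V} := fun v => v \in lin.

Lemma lin_gen x : X x -> x \in lin_pred.
Proof.
move=> Xx; apply/mem_set; exists 1%N, (fun=> 1), (fun=> x).
by rewrite big_ord1 scale1r.
Qed.

Fact lin_subsemimod_closed : subsemimod_closed lin_pred.
Proof.
split; [split|].
- apply/mem_set; exists 0%N, (fun=> 0), (fun=> 0).
  by split=> [[]//|]; rewrite big_ord0.
- move=> _ _ /set_mem[m [c [x [Xx ->]]]] /set_mem[n [d [y [Xy ->]]]].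
  apply/mem_set.
  exists (m + n)%N, (fun i : 'I_(m + n) => match fintype.split i with inl j => c j | inr j => d j end),
    (fun i : 'I_(m + n) => match fintype.split i with inl j => x j | inr j => y j end).
  split=> [i|]; first by case: splitP.
  rewrite big_split_ord /=; congr (_ + _); apply: eq_bigr => i _.
    by rewrite (unsplitK (inl i)).
  by rewrite (unsplitK (inr i)).
- move=> a _ /set_mem[n [c [x [Xx ->]]]]; apply/mem_set.
  exists n, (fun i => a * c i), x; split=> //.
  by rewrite scaler_sumr; apply: eq_bigr => i _; rewrite scalerA.
Qed.

Record lin_space := LinSpace { lin_val :> V ; _ : lin_val \in lin_pred }.

HB.instance Definition _ := [isSub for lin_val].
HB.instance Definition _ := [Choice of lin_space by <:].
HB.instance Definition _ :=
  GRing.SubChoice_isSubLmodule.Build K V lin_pred lin_space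
    lin_subsemimod_closed.

End LinearSpan.

Section LinearSpanInduction.
Variables (K : pzRingType) (V : lmodType K) (X : set V).

Lemma lin_space_ind (P : lin_space X -> Prop) :
  (forall a u v, P u -> P v -> P (a *: u + v)) ->
  (forall x (Xx : X x), P (LinSpace (lin_gen Xx))) ->
  P 0 -> forall v, P v.
Proof.
move=> Plin Pgen P0 v; have [n [c [x [Xx vE]]]] := set_mem (valP v).
have -> : v = \sum_(i < n) c i *: LinSpace (lin_gen (Xx i)).
  by apply/val_inj; rewrite raddf_sum /= vE.
by elim/big_ind: _ => // [y z Py Pz|i _];
  [rewrite -[y]scale1r|rewrite -[_ *: _]addr0]; exact: Plin.
Qed.

End LinearSpanInduction.

(* D is dil_space, its generators are the dil_gen s f, and the operators Phi(u),
   T and S are dil_rep u, dil_in and dil_out. As operators determined by their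
   values on the generators, Phi(u) and S are chosen from dil_rep_exists and
   dil_out_exists; dil_linear_unique makes the choice irrelevant. *)
Section Dilation.
Variables (K : comPzRingType) (S : monoidType) (E F : lmodType K).
Variable phi : S -> {linear F -> E}.

Definition phi_fun (s : S) (f : F) : S -> E := fun t => phi (t * s)%g f.

Definition dil_gens : set (S -> E) := [set phi_fun s f | s in setT & f in setT].

Definition dil_space := lin_space dil_gens.
HB.instance Definition _ := GRing.Lmodule.on dil_space.

Lemma phi_fun_gen s f : dil_gens (phi_fun s f).
Proof. by exists s => //; exists f. Qed.

Definition dil_gen (s : S) (f : F) : dil_space :=
  LinSpace (lin_gen (phi_fun_gen s f)).

Lemma dil_linear_unique (W : lmodType K) (P Q : {linear dil_space -> W}) :
  (forall s f, P (dil_gen s f) = Q (dil_gen s f)) -> P = Q.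
Proof.
move=> PQ; apply: linear_ext; apply: lin_space_ind => [a u v Pu Pv|x Xx|].
- by rewrite !linearP Pu Pv.
- have [s _ [f _ xE]] := Xx; have := PQ s f.
  by rewrite (_ : dil_gen s f = LinSpace (lin_gen Xx)) //; exact/val_inj.
- by rewrite !linear0.
Qed.

Lemma dil_rep_exists (u : S) : exists P : {linear dil_space -> dil_space},
  forall s f, P (dil_gen s f) = dil_gen (u * s)%g f.
Proof.
pose tr (g : S -> E) : S -> E := fun t => g (t * u)%g.
have tr_gen s f : tr (phi_fun s f) = phi_fun (u * s)%g f.
  by apply/funext => t; rewrite /tr /phi_fun mulgA.
have trD (g : dil_space) : tr (\val g) \in lin_pred dil_gens.
  have [n [c [x [Xx ->]]]] := set_mem (valP g).
  apply/mem_set; exists n, c, (fun i => tr (x i)); split=> [i|].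
    by have [s _ [f _ <-]] := Xx i; rewrite tr_gen; exact: phi_fun_gen.
  by apply/funext => t; rewrite /tr !fct_sumE.
pose P g : dil_space := LinSpace (trD g).
have Plin : linear P by move=> a g h; exact/val_inj.
pose L : {linear dil_space -> dil_space} :=
  HB.pack P (GRing.isLinear.Build _ _ _ _ P Plin).
by exists L => s f; apply/val_inj => /=; rewrite tr_gen.
Qed.

Definition dil_rep (u : S) : {linear dil_space -> dil_space} :=
  projT1 (cid (dil_rep_exists u)).

Lemma dil_repE u s f : dil_rep u (dil_gen s f) = dil_gen (u * s)%g f.
Proof. exact: projT2 (cid (dil_rep_exists u)) s f. Qed.

Lemma dil_out_exists : exists P : {linear dil_space -> E},
  forall s f, P (dil_gen s f) = phi s f.
Proof.
pose P (g : dil_space) : E := \val g 1%g.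
have Plin : linear P by [].
pose L : {linear dil_space -> E} :=
  HB.pack P (GRing.isLinear.Build _ _ _ _ P Plin).
by exists L => s f; rewrite /= /P /= /phi_fun mul1g.
Qed.

Definition dil_out : {linear dil_space -> E} := projT1 (cid dil_out_exists).

Lemma dil_outE s f : dil_out (dil_gen s f) = phi s f.
Proof. exact: projT2 (cid dil_out_exists) s f. Qed.

Definition dil_in_fun (f : F) : dil_space := dil_gen 1%g f.

Fact dil_in_fun_linear : linear dil_in_fun.
Proof.
by move=> a f g; apply/val_inj/funext => t /=; rewrite /phi_fun linearP.
Qed.

HB.instance Definition _ :=
  GRing.isLinear.Build K F dil_space *:%R dil_in_fun dil_in_fun_linear.

Definition dil_in : {linear F -> dil_space} := dil_in_fun.

End Dilation.

(* Main.v *)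
Require Import Defs.
From HB Require Import structures.
From mathcomp Require Import all_boot all_order all_algebra.
From mathcomp Require Import boolp classical_sets functions reals complex.

Set Implicit Arguments.
Unset Strict Implicit.
Unset Printing Implicit Defensive.

Import GRing.Theory.

Local Open Scope classical_set_scope.
Local Open Scope ring_scope.

(** A linear map out of [dil_space] is fixed by its values on the generators [dil_gen s f], so
    identities between operators become identities in the semigroup: associativity makes [dil_rep]
    multiplicative. Moreover [dil_in f] is the generator at the unit, so [dil_rep u] carries it to
    [dil_gen u f] ([dil_rep_dil_in]); the dilation formula and minimality follow. *)

Lemma lin_linear_closed (K : pzRingType) (V : lmodType K) (X : set V) a u v :
  lin X u -> lin X v -> lin X (a *: u + v).
Proof.
have [[_ linD] linZ] := lin_subsemimod_closed X.
move=> /mem_set Xu /mem_set Xv; apply: set_mem.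
by apply: linD => //; exact: linZ.
Qed.

Section DilationTheory.
Variables (K : comPzRingType) (E F : lmodType K).

Lemma dil_rep_monoid_morphism (S : monoidType) (phi : S -> {linear F -> E}) :
  monoid.monoid_morphism (dil_rep phi).
Proof.
split=> [|u v]; apply: dil_linear_unique => s f /=.
  by rewrite dil_repE mul1g.
by rewrite !dil_repE mulgA.
Qed.

(** Since [u * 1 = u], the vectors in the minimality condition are exactly the generators. *)
Lemma dil_rep_dil_in (S : monoidType) (phi : S -> {linear F -> E}) u f :
  dil_rep phi u (dil_in phi f) = dil_gen phi u f.
Proof. by rewrite /= dil_repE mulg1. Qed.

Lemma dil_out_dil_rep_dil_in (S : monoidType) (phi : S -> {linear F -> E}) u :
  phi u = dil_out phi \o dil_rep phi u \o dil_in phi :> (F -> E).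
Proof.
by apply/funext => f; rewrite -(dil_outE phi) -dil_rep_dil_in.
Qed.

Lemma dil_space_minimal (S : monoidType) (phi : S -> {linear F -> E}) :
  [set: dil_space phi] =
    lin [set dil_rep phi u (dil_in phi f) | u in setT & f in setT].
Proof.
apply/seteqP; split=> // v _; move: v.
apply: lin_space_ind => [a u v|x Xx|]; first exact: lin_linear_closed.
- have [s _ [f _ xE]] := Xx.
  apply/set_mem/lin_gen; exists s => //; exists f => //.
  (* Both sides have the same underlying function, which determines an element of the span. *)
  by rewrite dil_rep_dil_in; exact/val_inj.
- by have [[lin0 _] _] := lin_subsemimod_closed
    [set dil_rep phi u (dil_in phi f) | u in setT & f in setT]; exact: set_mem.
Qed.

Lemma dil_rep_linear (A : unitalAlgType K) (phi : A -> {linear F -> E}) :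
  linear phi -> linear (dil_rep phi).
Proof.
move=> phi_lin a u v; apply: dil_linear_unique => s f /=.
(* Evaluating at [t] reduces the claim to expanding [phi (t * ((a *: u + v) * s))], by bilinearity
   of the product and linearity of [phi]. *)
rewrite !dil_repE; apply/val_inj/funext => t /=.
by rewrite /phi_fun mulg_linearl mulg_linearr phi_lin.
Qed.

End DilationTheory.

Theorem theorem8 (R : realType) (k : scalar_kind)
    (E F : lmodType (scalar_field R k)) :
  (forall (S : monoidType) (phi : S -> {linear F -> E}),
    [/\ monoid.monoid_morphism (dil_rep phi) /\
        ((forall u v : S, commute u v) ->
         forall P Q, range (dil_rep phi) P -> range (dil_rep phi) Q ->
           commute P Q),
        forall u : S, phi u = dil_out phi \o dil_rep phi u \o dil_in phi
                      :> (F -> E) &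
        [set: dil_space phi] =
          lin [set dil_rep phi u (dil_in phi f) | u in setT & f in setT]]) /\
  (forall (A : unitalAlgType (scalar_field R k)) (phi : A -> {linear F -> E}),
    linear phi -> algebra_morphism (dil_rep phi)).
Proof.
split=> [S phi|A phi phi_lin]; last first.
  (* Multiplicativity is the semigroup case applied to the multiplicative monoid of [A]. *)
  by split; [exact: dil_rep_linear|exact: dil_rep_monoid_morphism].
have [_ repM] := dil_rep_monoid_morphism phi.
split; [|exact: dil_out_dil_rep_dil_in|exact: dil_space_minimal].
split=> [|comS _ _ [u _ <-] [v _ <-]]; first exact: dil_rep_monoid_morphism.
(* Both products are values of [dil_rep], at [u * v] and at [v * u]. *)
by rewrite /commute -!repM comS.
Qed.
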